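(* Let $\{\lambda_k\}_{k\in\mathbb{N}}$ be a sequence of positive numbers, and consider the countable system of harmonic oscillators with Hamilton function $H(q,p)=\sum_{k=1}^\infty\frac{\lambda_k}{2}(p_k^2+q_k^2)$ in the phase space $E$ of pairs $(q,p)$ of real square-summable sequences. Then every point of the phase space $E$ is nonwandering under the flow $\{\mathbf{\Phi}_t\}_{t\in\mathbb{R}}$ of this Hamiltonian system.
   Context: $E=\ell^2(\mathbb{N},\mathbb{R})\oplus\ell^2(\mathbb{N},\mathbb{R})$ is identified with the complex space $\ell^2(\mathbb{N},\mathbb{C})$ via $z_k=q_k+ip_k$. (This is the system of harmonic oscillators with $X=\mathbb{N}$ and $\mu$ the counting measure, i.e. with a point measure.) The flow of the Hamiltonian system on $E$ is given by $(\mathbf{\Phi}_tz)_k=e^{i\lambda_kt}z_k$, $t\in\mathbb{R}$, $k\in\mathbb{N}$. A point $A\in E$ is nonwandering if for every neighborhood $\mathcal{O}(A)$ of $A$ in $E$ and every $T>0$ there exists $t>T$ such that $\mathcal{O}(A)\cap\mathbf{\Phi}_t(\mathcal{O}(A))\neq\emptyset$. *)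

(* Defs.v *)
From HB Require Import structures.
From mathcomp Require Import all_boot all_order all_algebra.
From mathcomp Require Import all_classical all_reals all_analysis.
From mathcomp Require Import complex ring.

Set Implicit Arguments.
Unset Strict Implicit.
Unset Printing Implicit Defensive.
Import Order.TTheory GRing.Theory Num.Theory.
Import numFieldNormedType.Exports.
Local Open Scope classical_set_scope.
Local Open Scope ring_scope.

(* Real square-summable sequences are L^2 of the counting measure on nat; the
   empty set is the only null set, so no a.e. quotient is needed.  See
   [l2_normE], [l2_square_summable] and [mk_l2] for the description by series. *)
Definition l2 (R : realType) : Type :=
  LfunType (T := nat) (R := R) counting (p := 2%:E) (lee1n 2).

HB.instance Definition _ (R : realType) := GRing.Lmodule.on (l2 R).

Definition l2_fun (R : realType) (f : l2 R) : nat -> R :=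
  (f : LfunType (T := nat) (R := R) counting (p := 2%:E) (lee1n 2)).
Coercion l2_fun : l2 >-> Funclass.

Section l2_norm.
Context {R : realType}.
Implicit Types f g : l2 R.

Definition l2_norm f : R := fine ('N[counting]_2%:E [EFin \o f])%E.

Lemma l2_normEFin f : (l2_norm f)%:E = ('N[counting]_2%:E [EFin \o f])%E.
Proof. exact: (@finite_norm_fine _ nat R counting 2%:E (lee1n 2)). Qed.

Lemma l2_normD f g : l2_norm (f + g) <= l2_norm f + l2_norm g.
Proof. exact: (@ler_LnormD _ nat R counting 2%:E (lee1n 2)). Qed.

Lemma l2_normZ (a : R) f : l2_norm (a *: f) = `|a| * l2_norm f.
Proof.
apply: EFin_inj; rewrite EFinM (l2_normEFin f) (l2_normEFin (a *: f)).
exact: (@LnormZ _ nat R counting 2%:E (lee1n 2) f a).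
Qed.

Lemma l2_norm0_eq0 f : l2_norm f = 0 -> f = 0.
Proof.
move=> /(@fine_Lnormr_eq0 _ nat R counting 2%:E (lee1n 2)) [N [mN N0 sub]].
apply/(@LfuneqP _ nat R counting 2%:E (lee1n 2)) => k; apply: contrapT => fk.
have Nk : N k by apply: sub => /(_ I).
have : (counting [set k] <= counting N :> \bar R)%E.
  by apply: le_measure; rewrite ?inE// => _ ->.
rewrite N0 /counting asboolT; last exact: finite_set1.
by rewrite fset_set1 finmap.cardfs1 lee_fin ler10.
Qed.

HB.instance Definition _ := @Lmodule_isNormed.Build R (l2 R)
  l2_norm l2_normD l2_normZ l2_norm0_eq0.

Lemma l2P f g : f = g <-> f =1 g.
Proof. exact: (@LfuneqP _ nat R counting 2%:E (lee1n 2)). Qed.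

Let sumsqr_ge0 (u : nat -> R) : (0 <= \sum_(k <oo) (u k ^+ 2)%:E)%E.
Proof. by apply: nneseries_ge0 => k _ _; rewrite lee_fin sqr_ge0. Qed.

Lemma Lnorm_counting2 (u : nat -> R) :
  ('N[counting]_2%:E [EFin \o u] = sqrte (\sum_(k <oo) (u k ^+ 2)%:E))%E.
Proof.
rewrite Lnorm_counting// -poweR12_sqrt//.
congr (_ `^ _)%E; apply: eq_eseriesr => k _ /=.
by rewrite powR_mulrn// -normrX ger0_norm ?sqr_ge0.
Qed.

Lemma l2_square_summable f : (\sum_(k <oo) (f k ^+ 2)%:E < +oo)%E.
Proof.
have := Lnorm_counting2 f; rewrite -(l2_normEFin f).
by case: (\sum_(k <oo) (f k ^+ 2)%:E)%E => // r _; rewrite ltry.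
Qed.

Lemma l2_normE f : `|f| = Num.sqrt (fine (\sum_(k <oo) (f k ^+ 2)%:E)%E).
Proof.
apply: EFin_inj; rewrite [LHS](l2_normEFin f) [LHS](Lnorm_counting2 f).
have := l2_square_summable f.
have := sumsqr_ge0 f.
by case: (\sum_(k <oo) (f k ^+ 2)%:E)%E.
Qed.

Lemma square_summable_Lfun (u : nat -> R) :
  (\sum_(k <oo) (u k ^+ 2)%:E < +oo)%E -> u \in Lfun counting 2%:E.
Proof.
move=> ufin; rewrite inE; apply/andP; split; rewrite inE//=.
rewrite /finite_norm Lnorm_counting2.
move: ufin (sumsqr_ge0 u).
by case: (\sum_(k <oo) (u k ^+ 2)%:E)%E => // r _ _; rewrite ltry.
Qed.

Definition mk_l2 (u : nat -> R)
    (usum : (\sum_(k <oo) (u k ^+ 2)%:E < +oo)%E) : l2 R :=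
  Lfun_Sub (lee1n 2) (square_summable_Lfun usum).

End l2_norm.

(* Pairs (q, p).  The norm of the product is the maximum of the two l2 norms,
   which is equivalent to the Hilbert norm of the direct sum and hence induces
   the same neighbourhoods. *)
Definition phase_space (R : realType) : Type := (l2 R * l2 R)%type.
HB.instance Definition _ (R : realType) :=
  NormedModule.copy (phase_space R) (l2 R * l2 R)%type.

Section harmonic_oscillators.
Context {R : realType}.
Implicit Types (z : phase_space R) (lambda : nat -> R) (t : R).

(* Extended-valued: the energy of a state may be +oo when lambda is unbounded. *)
Definition hamiltonian lambda z : \bar R :=
  (\sum_(k <oo) (lambda k / 2 * (z.2 k ^+ 2 + z.1 k ^+ 2))%:E)%E.

Definition zcoord z (k : nat) : R[i] := (z.1 k +i* z.2 k)%C.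

Definition expi (x : R) : R[i] := (cos x +i* sin x)%C.

Definition flow_coord lambda t z k : R[i] :=
  expi (lambda k * t) * zcoord z k.

Lemma Re_flow_coord lambda t z k : complex.Re (flow_coord lambda t z k) =
  cos (lambda k * t) * z.1 k - sin (lambda k * t) * z.2 k.
Proof. by []. Qed.

Lemma Im_flow_coord lambda t z k : complex.Im (flow_coord lambda t z k) =
  cos (lambda k * t) * z.2 k + sin (lambda k * t) * z.1 k.
Proof. by []. Qed.

Lemma flow_coord_norm lambda t z k :
  complex.Re (flow_coord lambda t z k) ^+ 2 +
  complex.Im (flow_coord lambda t z k) ^+ 2 = z.1 k ^+ 2 + z.2 k ^+ 2.
Proof.
rewrite Re_flow_coord Im_flow_coord.
have := cos2Dsin2 (lambda k * t).
set c := cos _; set s := sin _; set q := z.1 k; set p := z.2 k => cs.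
transitivity ((c ^+ 2 + s ^+ 2) * (q ^+ 2 + p ^+ 2)); first by ring.
by rewrite cs mul1r.
Qed.

Let phase_summable z : (\sum_(k <oo) (z.1 k ^+ 2 + z.2 k ^+ 2)%:E < +oo)%E.
Proof.
under eq_eseriesr do rewrite EFinD.
rewrite nneseriesD; [|by move=> *; rewrite lee_fin sqr_ge0..].
by rewrite lte_add_pinfty// l2_square_summable.
Qed.

Lemma Re_flow_summable lambda t z :
  (\sum_(k <oo) (complex.Re (flow_coord lambda t z k) ^+ 2)%:E < +oo)%E.
Proof.
apply: le_lt_trans (phase_summable z).
apply: lee_nneseries => k _ *; rewrite lee_fin ?sqr_ge0//.
by rewrite -(flow_coord_norm lambda t) lerDl sqr_ge0.
Qed.

Lemma Im_flow_summable lambda t z :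
  (\sum_(k <oo) (complex.Im (flow_coord lambda t z k) ^+ 2)%:E < +oo)%E.
Proof.
apply: le_lt_trans (phase_summable z).
apply: lee_nneseries => k _ *; rewrite lee_fin ?sqr_ge0//.
by rewrite -(flow_coord_norm lambda t) lerDr sqr_ge0.
Qed.

Definition flow lambda t z : phase_space R :=
  (mk_l2 (Re_flow_summable lambda t z), mk_l2 (Im_flow_summable lambda t z)).

Lemma flowE lambda t z k :
  zcoord (flow lambda t z) k = expi (lambda k * t) * zcoord z k.
Proof. by []. Qed.

Lemma flow1E lambda t z k : (flow lambda t z).1 k =
  cos (lambda k * t) * z.1 k - sin (lambda k * t) * z.2 k.
Proof. by []. Qed.

Lemma flow2E lambda t z k : (flow lambda t z).2 k =
  cos (lambda k * t) * z.2 k + sin (lambda k * t) * z.1 k.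
Proof. by []. Qed.

Lemma hamiltonian_flow lambda t z :
  hamiltonian lambda (flow lambda t z) = hamiltonian lambda z.
Proof.
apply: eq_eseriesr => k _; congr (_ * _)%:E.
by rewrite addrC flow_coord_norm addrC.
Qed.

Lemma delta_summable (k : nat) :
  (\sum_(j <oo) ((j == k)%:R ^+ 2 : R)%:E < +oo)%E.
Proof.
rewrite (@nneseriesD1 _ _ k xpredT)//.
rewrite eseries0; last by move=> j _ /= /negPf ->; rewrite expr0n.
by rewrite adde0 ltry.
Qed.

Definition delta_l2 (k : nat) : l2 R := mk_l2 (delta_summable k).

Lemma is_derive_hamiltonian lambda z (v : phase_space R) k (a b : R) :
  (forall j, 0 < lambda j) ->
  (forall j, v.1 j = a * (j == k)%:R) -> (forall j, v.2 j = b * (j == k)%:R) ->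
  (hamiltonian lambda z < +oo)%E ->
  is_derive z v (fine \o hamiltonian lambda)
    (lambda k * (a * z.1 k + b * z.2 k)).
Proof.
move=> l0 va vb zfin.
pose g (h : R) : R := h * (lambda k * (a * z.1 k + b * z.2 k)) +
  h ^+ 2 * (lambda k / 2 * (a ^+ 2 + b ^+ 2)).
have gE (h : R) : fine (hamiltonian lambda (h *: v + z)) -
    fine (hamiltonian lambda z) = g h.
  have t_ge0 (w : phase_space R) j : (0 <= (lambda j / 2 * (w.2 j ^+ 2 + w.1 j ^+ 2))%:E)%E.
    by rewrite lee_fin mulr_ge0 ?divr_ge0 ?addr_ge0 ?sqr_ge0// ltW.
  pose S (w : phase_space R) := (\sum_(0 <= j <oo | j != k)
    (lambda j / 2 * (w.2 j ^+ 2 + w.1 j ^+ 2))%:E)%E.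
  have HE (w : phase_space R) : hamiltonian lambda w =
      ((lambda k / 2 * (w.2 k ^+ 2 + w.1 k ^+ 2))%:E + S w)%E.
    by rewrite /hamiltonian (@nneseriesD1 _ _ k xpredT).
  have v1 j : (h *: v + z).1 j = h * (a * (j == k)%:R) + z.1 j by rewrite -va.
  have v2 j : (h *: v + z).2 j = h * (b * (j == k)%:R) + z.2 j by rewrite -vb.
  have SE : S (h *: v + z) = S z.
    apply: eq_eseriesr => j /negPf jk.
    by rewrite v1 v2 jk !mulr0 !add0r.
  have S0 : (0 <= S z)%E by apply: nneseries_ge0 => j _ _; exact: t_ge0.
  move: zfin; rewrite !HE SE v1 v2 eqxx !mulr1.
  case: (S z) S0 => [r| |]//= _ _.
  by rewrite /g; field.
have gcvg : (fun h => h^-1 *: (fine (hamiltonian lambda (h *: v + z)) -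
    fine (hamiltonian lambda z))) @ 0^' -->
    lambda k * (a * z.1 k + b * z.2 k).
  apply: (@cvg_trans _ ((fun h : R => lambda k * (a * z.1 k + b * z.2 k) +
    h * (lambda k / 2 * (a ^+ 2 + b ^+ 2))) @ 0^')).
    apply: near_eq_cvg; near=> h.
    have h0 : h != 0 by near: h; exact: nbhs_dnbhs_neq.
    rewrite gE /g -[_ *: _]/(_ * _) expr2.
    by field.
  have h0 : (fun h : R => h) @ 0^' --> (0 : R) by exact: cvg_within.
  have := cvgD (cvg_cst (lambda k * (a * z.1 k + b * z.2 k)))
    (cvgM h0 (cvg_cst (lambda k / 2 * (a ^+ 2 + b ^+ 2)))).
  by rewrite mul0r addr0; exact.
split; first by apply/cvg_ex; eexists; exact: gcvg.
exact: (cvg_lim _ gcvg).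
Unshelve. all: by end_near. Qed.

Lemma is_derive_flow lambda z k t :
  is_derive t 1 (fun s => (flow lambda s z).1 k)
    (- (lambda k * (flow lambda t z).2 k)) /\
  is_derive t 1 (fun s => (flow lambda s z).2 k)
    (lambda k * (flow lambda t z).1 k).
Proof.
have dl : is_derive t 1 (fun s : R => lambda k * s) (lambda k).
  have := @is_deriveZ _ _ _ id (lambda k) t 1 1 (is_derive_id _ _).
  by rewrite [_ *: 1]mulr1.
have dc := @is_derive1_comp R (@cos R) (fun s : R => lambda k * s) t _ _
  (is_derive_cos _) dl.
have ds := @is_derive1_comp R (@sin R) (fun s : R => lambda k * s) t _ _
  (is_derive_sin _) dl.
split.
- have -> : (fun s => (flow lambda s z).1 k) =
      (z.1 k \*: (@cos R \o (fun s : R => lambda k * s))) -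
      (z.2 k \*: (@sin R \o (fun s : R => lambda k * s))).
    by apply/funext => s; rewrite flow1E mulrC [sin _ * _]mulrC.
  apply: is_derive_eq; rewrite flow2E -![_ *: _]/(_ * _).
  by ring.
- have -> : (fun s => (flow lambda s z).2 k) =
      (z.2 k \*: (@cos R \o (fun s : R => lambda k * s))) +
      (z.1 k \*: (@sin R \o (fun s : R => lambda k * s))).
    by apply/funext => s; rewrite flow2E mulrC [sin _ * _]mulrC.
  apply: is_derive_eq; rewrite flow1E -![_ *: _]/(_ * _).
  by ring.
Qed.

(* The flow solves Hamilton's equations on the finite-energy states.  With
   z_k = q_k + i p_k, the rotation e^{i lambda_k t} corresponds to the
   orientation q' = - dH/dp, p' = dH/dq of the symplectic form; the opposite
   orientation gives the time-reversed flow. *)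
Lemma hamilton_equations lambda z k t :
  (forall j, 0 < lambda j) -> (hamiltonian lambda z < +oo)%E ->
  is_derive t 1 (fun s => (flow lambda s z).1 k)
    (- 'D_((0, delta_l2 k) : phase_space R)
         (fine \o hamiltonian lambda) (flow lambda t z)) /\
  is_derive t 1 (fun s => (flow lambda s z).2 k)
    ('D_((delta_l2 k, 0) : phase_space R)
         (fine \o hamiltonian lambda) (flow lambda t z)).
Proof.
move=> l0 zfin; set w := flow lambda t z.
have wfin : (hamiltonian lambda w < +oo)%E by rewrite hamiltonian_flow.
have dp := @is_derive_hamiltonian lambda w (0, delta_l2 k) k 0 1 l0
  (fun j => esym (mul0r _)) (fun j => esym (mul1r _)) wfin.
have dq := @is_derive_hamiltonian lambda w (delta_l2 k, 0) k 1 0 l0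
  (fun j => esym (mul1r _)) (fun j => esym (mul0r _)) wfin.
have [f1 f2] := is_derive_flow lambda z k t.
split.
- by rewrite (@derive_val _ _ _ _ _ _ _ dp) mul0r add0r mul1r.
- by rewrite (@derive_val _ _ _ _ _ _ _ dq) mul0r addr0 mul1r.
Qed.

End harmonic_oscillators.

Definition nonwandering (R : realType) (T : topologicalType)
    (phi : R -> T -> T) (A : T) : Prop :=
  forall O : set T, nbhs A O -> forall T0 : R, 0 < T0 ->
    exists2 t : R, T0 < t & O `&` (phi t @` O) !=set0.

(* Main.v *)
Require Import Defs.
From mathcomp Require Import all_boot all_order all_algebra.
From mathcomp Require Import all_classical all_reals all_analysis.
From mathcomp Require Import ring lra.
Import Order.TTheory GRing.Theory Num.Theory.
Import numFieldNormedType.Exports.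
Local Open Scope ring_scope.

(** Every point is in fact recurrent: [flow lambda t A] returns arbitrarily
    close to [A] at arbitrarily large times ([flow_recurrent]), which is
    stronger than nonwandering because the point of the neighbourhood that
    comes back to it can be taken to be [A] itself.

    The flow rotates the k-th coordinate by the angle [lambda k * t], so
    that [|(flow t A)_k - A_k|^2 = 2 (1 - cos (lambda k * t)) |A_k|^2].  Since
    [A] is square summable, the coordinates beyond some [N] contribute little
    to the distance, uniformly in [t], because a rotation displaces a point by
    at most twice its modulus.  The first [N] coordinates are handled by
    Dirichlet's pigeonhole principle ([simultaneous_return]): among the
    positions at the times [n * s], [n = 0, 1, 2, ...], of the [N] points on
    their circles, two agree up to a small error, and the difference of the
    two times is a time at which all [N] rotations are close to the identity;
    taking [s] large makes this time large. *)

(** Dirichlet's box principle: cut [[-1, 1]] into boxes of length at most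
    [delta]; the cube has finitely many products of boxes, so two of the
    points share one. *)
Lemma bounded_seq_close_pair (R : realType) (I : finType) (u : nat -> I -> R)
    (delta : R) :
  0 < delta -> (forall n k, -1 <= u n k <= 1) ->
  exists m n : nat, (m < n)%N /\ forall k, `|u n k - u m k| <= delta.
Proof.
move=> delta0 u1.
pose M := (Num.truncn delta^-1).+1.
have M0 : (0 : R) < M%:R by rewrite ltr0n.
have Mdelta : 1 <= M%:R * delta.
  by rewrite -ler_pdivrMr// div1r ltW// truncnS_gt.
pose box (x : R) := Num.truncn (M%:R * (x + 1)).
have box_itv x : -1 <= x -> (box x)%:R <= M%:R * (x + 1) < (box x).+1%:R.
  move=> x1; apply: truncn_itv.
  by rewrite mulr_ge0 ?ler0n//; lra.
have box_lt n k : (box (u n k) < (2 * M).+1)%N.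
  have /andP[l1 l2] := u1 n k; have /andP[b1 _] := box_itv _ l1.
  rewrite ltnS -(ler_nat R) (le_trans b1)// natrM mulrC.
  by rewrite ler_wpM2r ?ler0n//; lra.
pose G := {ffun I -> 'I_(2 * M).+1}.
pose f (n : 'I_#|G|.+1) : G := [ffun k => Ordinal (box_lt n k)].
have /injectivePn[m [n mn fmn]] : ~~ injectiveb f.
  by apply/negP => /injectiveP/leq_card; rewrite card_ord ltnn.
have close k : `|u n k - u m k| <= delta.
  have := congr1 (fun g : G => val (g k)) fmn.
  rewrite !ffunE/= => bE.
  have /andP[m1 _] := u1 m k; have /andP[n1 _] := u1 n k.
  have := box_itv _ m1; have := box_itv _ n1; rewrite bE -natr1.
  move=> /andP[a1 a2] /andP[b1 b2].
  rewrite -(ler_pM2l M0) (le_trans _ Mdelta)// -[in leLHS](gtr0_norm M0).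
  by rewrite -normrM ler_norml; apply/andP; split; lra.
move: mn; rewrite -val_eqE/= neq_ltn => /orP[mn|mn].
  by exists m, n.
by exists n, m; split=> // k; rewrite distrC.
Qed.

(** Two nearly equal positions on a circle, reached at different times, give
    a near-identity rotation over the elapsed time, by
    [(cos a - cos b)^2 + (sin a - sin b)^2 = 2 (1 - cos (a - b))]. *)
Lemma simultaneous_return (R : realType) (lambda : nat -> R) (N : nat)
    (eta T : R) : 0 < eta -> 0 < T ->
  exists2 t, T < t & forall k, (k < N)%N -> 1 - cos (lambda k * t) <= eta.
Proof.
move=> eta0 T0; pose s := T + 1.
pose u (n : nat) (k : 'I_N * bool) : R :=
  let a := lambda k.1 * (n%:R * s) in if k.2 then cos a else sin a.
(* The identity above bounds [1 - cos (a - b)] by [delta ^ 2 <= eta]. *)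
pose delta := Num.min 1 eta.
have delta0 : 0 < delta by rewrite lt_min ltr01.
have [|m [n [mn close]]] := bounded_seq_close_pair R _ u delta delta0.
  move=> j [k []] /=; first by rewrite cos_geN1 cos_le1.
  by rewrite sin_geN1 sin_le1.
exists (n%:R * s - m%:R * s).
  (* The elapsed time is at least one sampling step [s], hence exceeds [T]. *)
  have : (m%:R + 1 : R) <= n%:R by rewrite natr1 ler_nat.
  by rewrite /s; nra.
move=> k kN; rewrite mulrBr cosB.
have := close (Ordinal kN, true); have := close (Ordinal kN, false).
rewrite /u/=; set a := lambda k * (n%:R * s); set b := lambda k * (m%:R * s).
have delta1 : delta <= 1 by rewrite ge_min lexx.
have delta_eta : delta <= eta by rewrite ge_min lexx orbT.
rewrite !ler_norml => /andP[s1 s2] /andP[c1 c2].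
have ha := cos2Dsin2 a; have hb := cos2Dsin2 b.
have hs : (sin a - sin b) ^+ 2 <= delta ^+ 2 by nra.
have hc : (cos a - cos b) ^+ 2 <= delta ^+ 2 by nra.
nra.
Qed.

Lemma l2_norm_lt (R : realType) (f : l2 R) (e : R) : 0 < e ->
  (\sum_(k <oo) (f k ^+ 2)%:E < (e ^+ 2)%:E)%E -> `|f| < e.
Proof.
move=> e0; rewrite l2_normE.
have : (0 <= \sum_(k <oo) (f k ^+ 2)%:E)%E.
  by apply: nneseries_ge0 => k _ _; rewrite lee_fin sqr_ge0.
case: (\sum_(k <oo) (f k ^+ 2)%:E)%E => //= r; rewrite lee_fin lte_fin => r0 re.
by rewrite -[ltRHS](gtr0_norm e0) -sqrtr_sqr ltr_sqrt// exprn_gt0.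
Qed.

Lemma flow_displacement (R : realType) (lambda : nat -> R) (t : R)
    (A : phase_space R) (k : nat) :
  (A.1 k - (flow lambda t A).1 k) ^+ 2 + (A.2 k - (flow lambda t A).2 k) ^+ 2
  = 2 * (1 - cos (lambda k * t)) * (A.1 k ^+ 2 + A.2 k ^+ 2).
Proof.
rewrite flow1E flow2E; have := cos2Dsin2 (lambda k * t).
set c := cos _; set s := sin _; set q := A.1 k; set p := A.2 k => cs.
transitivity ((1 - 2 * c + (c ^+ 2 + s ^+ 2)) * (q ^+ 2 + p ^+ 2)).
  by ring.
by rewrite cs; ring.
Qed.

Lemma phase_space_norm_lt (R : realType) (z : phase_space R) (e : R) : 0 < e ->
  (\sum_(k <oo) (z.1 k ^+ 2 + z.2 k ^+ 2)%:E < (e ^+ 2)%:E)%E -> `|z| < e.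
Proof.
move=> e0 ze; rewrite [`|z|]prod_normE gt_max; apply/andP; split.
  apply: l2_norm_lt => //; apply: le_lt_trans ze.
  by apply: lee_nneseries => k *; rewrite lee_fin ?sqr_ge0// lerDl sqr_ge0.
apply: l2_norm_lt => //; apply: le_lt_trans ze.
by apply: lee_nneseries => k *; rewrite lee_fin ?sqr_ge0// lerDr sqr_ge0.
Qed.

Lemma phase_space_summable (R : realType) (z : phase_space R) :
  (\sum_(k <oo) (z.1 k ^+ 2 + z.2 k ^+ 2)%:E < +oo)%E.
Proof.
under eq_eseriesr do rewrite EFinD.
rewrite nneseriesD; [|by move=> *; rewrite lee_fin sqr_ge0..].
by rewrite lte_add_pinfty// l2_square_summable.
Qed.

Lemma nneseries_small_tail (R : realType) (w : nat -> R) (d : R) :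
  0 < d -> (forall k, 0 <= w k) -> (\sum_(k <oo) (w k)%:E < +oo)%E ->
  exists N : nat, (\sum_(N <= k <oo) (w k)%:E < d%:E)%E.
Proof.
move=> d0 w0 wfin.
have := nneseries_tail_cvg wfin (fun k _ => w0 k : (0 <= (w k)%:E)%E).
move=> /(_ _ (@nbhs_open_ereal_lt R 0 (fun=> d) d0)) [N _ tail].
by exists N; apply: tail => /=.
Qed.

(** The tail beyond [N] is controlled by [1 - cos <= 2] for all times at once,
    so that [N] can be fixed before the return time of the head is chosen. *)
Lemma flow_recurrent (R : realType) (lambda : nat -> R) (A : phase_space R)
    (e T : R) : 0 < e -> 0 < T ->
  exists2 t, T < t & `|A - flow lambda t A| < e.
Proof.
move=> e0 T0; pose w k := A.1 k ^+ 2 + A.2 k ^+ 2.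
have w0 k : 0 <= w k by rewrite addr_ge0 ?sqr_ge0.
have wfin : (\sum_(k <oo) (w k)%:E < +oo)%E := phase_space_summable R A.
have e2 : 0 < e ^+ 2 by rewrite exprn_gt0.
have [N tailN] : exists N : nat,
    (\sum_(N <= k <oo) (w k)%:E < (e ^+ 2 / 8)%:E)%E.
  by apply: nneseries_small_tail => //; rewrite divr_gt0.
pose r := \sum_(0 <= k < N) w k.
have r0 : 0 <= r by apply: sumr_ge0.
(* The head contributes at most [2 * eta * r], and the [+ 1] covers [r = 0]. *)
pose eta := e ^+ 2 / (4 * (r + 1)).
have r4 : 0 < 4 * (r + 1) by lra.
have eta0 : 0 < eta by rewrite divr_gt0.
have [t Tt close] := simultaneous_return R lambda N eta T eta0 T0.
exists t => //; apply: phase_space_norm_lt => //.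
pose d k := 2 * (1 - cos (lambda k * t)) * w k.
have d0 k : 0 <= d k.
  by rewrite mulr_ge0// mulr_ge0// subr_ge0 cos_le1.
rewrite (_ : (\sum_(k <oo) _ = \sum_(k <oo) (d k)%:E)%E); last first.
  by apply: eq_eseriesr => k _; rewrite -[d k]flow_displacement.
rewrite (nneseries_split 0 N); last by move=> k _; rewrite lee_fin.
rewrite add0n sumEFin.
have head : \sum_(0 <= k < N) d k <= e ^+ 2 / 2.
  apply: (@le_trans _ _ (2 * eta * r)).
    rewrite /r mulr_sumr; apply: ler_sum_nat => k /andP[_ kN].
    by rewrite ler_wpM2r// ler_wpM2l// close.
  have -> : 2 * eta * r = e ^+ 2 / 2 * (r / (r + 1)).
    by rewrite /eta; field; lra.
  by rewrite ler_piMr//; [lra|rewrite ler_pdivrMr; lra].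
have tail : (\sum_(N <= k <oo) (d k)%:E < (e ^+ 2 / 2)%:E)%E.
  apply: (@le_lt_trans _ _ (4%:E * \sum_(N <= k <oo) (w k)%:E)%E).
    rewrite -nneseriesZl; last by move=> k _; rewrite lee_fin.
    apply: lee_nneseries => k *; rewrite lee_fin//.
    by rewrite ler_wpM2r//; have := cos_geN1 (lambda k * t); lra.
  rewrite (_ : e ^+ 2 / 2 = 4 * (e ^+ 2 / 8)); last by field.
  by rewrite EFinM lte_pmul2l// lte_fin.
rewrite [e ^+ 2]splitr EFinD.
by apply: lee_ltD => //; rewrite ?lee_fin.
Qed.

Theorem theorem7p2 (R : realType) (lambda : nat -> R)
    (lambda_gt0 : forall k : nat, 0 < lambda k) (A : phase_space R) :
  nonwandering (flow lambda) A.
Proof.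
move=> O /nbhs_ballP[e /= e0 AO] T T0.
have [t Tt close] := flow_recurrent R lambda A e T e0 T0.
exists t => //; exists (flow lambda t A); split.
  by apply: AO; rewrite -ball_normE.
by exists A => //; apply: AO; exact: ballxx.
Qed.
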